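(* Let $n,k$ be integers with $2\le k\le n/2$. A regular $2n$-gon is infinitesimally rigid as a self-Bäcklund $(n,k)$-gon unless one of the following holds: (1) $n$ is even and $k$ is odd; (2) $n=2k$ with even $k>2$; (3) there exists an integer $j$ with $2\le j\le n-2$ such that $n=2(k+j)$ and $n$ divides $(k-1)(j-1)$. (That is, if none of (1)–(3) holds, then the regular $2n$-gon is infinitesimally rigid.)
   Context: For $u,v\in\mathbb{R}^2$, $[u,v]$ denotes the determinant of the matrix with columns $u,v$. A self-Bäcklund $(n,k)$-gon is an origin-symmetric $2n$-gon with vertices $P_i$ ($i$ modulo $2n$), $P_{i+n}=-P_i$, such that $[P_i,P_{i+1}]=1$ and $[P_i,P_{i+k}]=c$ for all $i$, for some constant $c$. A regular $2n$-gon means the convex regular $2n$-gon centered at the origin, with vertices $P_j=r(\cos(\pi j/n),\sin(\pi j/n))$, scaled by $r>0$ so that $[P_j,P_{j+1}]=1$. An infinitesimal deformation of it in the class of self-Bäcklund $(n,k)$-gons is a sequence of vectors $V_j\in\mathbb{R}^2$ with $V_{j+n}=-V_j$ such that, modulo $\varepsilon^2$, the polygon $P_j+\varepsilon V_j$ is a self-Bäcklund $(n,k)$-gon; i.e. $[P_j,V_{j+1}]+[V_j,P_{j+1}]=0$ and $[P_j,V_{j+k}]+[V_j,P_{j+k}]=C$ for all $j$, with $C$ a constant independent of $j$. The regular polygon is infinitesimally rigid as a self-Bäcklund $(n,k)$-gon if each such infinitesimal deformation is induced by the action of $\mathfrak{sl}_2(\mathbb{R})$, i.e. there is $A\in\mathfrak{sl}_2(\mathbb{R})$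 with $V_j=AP_j$ for all $j$. *)

(* Defs.v *)
From mathcomp Require Import all_boot all_order all_algebra.
From mathcomp Require Import reals trigo.

Set Implicit Arguments.
Unset Strict Implicit.
Unset Printing Implicit Defensive.

Import Order.TTheory GRing.Theory Num.Theory.
Local Open Scope ring_scope.

(* Polygons and deformation fields are families of plane vectors indexed by
   all of [int].  The antiperiodicity [P (j + n) = - P j] makes them
   2n-periodic, so that they are indexed modulo 2n. *)

Definition bracket (R : realType) (u v : 'cV[R]_2) : R :=
  \det (row_mx u v : 'M[R]_2).

Definition regular_polygon (R : realType) (n : nat) (r : R) (j : int) :
    'cV[R]_2 :=
  \col_(i < 2) (r * (if i == 0 then cos (pi * j%:~R / n%:R)
                     else sin (pi * j%:~R / n%:R))).

(* The coefficients of eps in the conditions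
     [P_j + eps V_j, P_(j+1) + eps V_(j+1)] = 1  and
     [P_j + eps V_j, P_(j+k) + eps V_(j+k)] = c + eps C
   stating that P + eps V is a self-Backlund (n,k)-gon modulo eps^2, when P
   itself is one: the constant c of the class may vary with eps. *)
Definition infinitesimal_deformation (R : realType) (n k : nat)
    (P V : int -> 'cV[R]_2) : Prop :=
  [/\ forall j : int, V (j + n%:Z) = - V j,
      forall j : int, bracket (P j) (V (j + 1)) + bracket (V j) (P (j + 1)) = 0
    & exists C : R, forall j : int,
        bracket (P j) (V (j + k%:Z)) + bracket (V j) (P (j + k%:Z)) = C].

Definition infinitesimally_rigid (R : realType) (n k : nat)
    (P : int -> 'cV[R]_2) : Prop :=
  forall V : int -> 'cV[R]_2, infinitesimal_deformation n k P V ->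
  exists2 A : 'M[R]_2, \tr A = 0 & forall j : int, V j = A *m P j.

(* Main.v *)
Require Import Defs.
From mathcomp Require Import all_boot all_order all_algebra all_field.
From mathcomp Require Import reals trigo complex ring zify.

Set Implicit Arguments.
Unset Strict Implicit.
Unset Printing Implicit Defensive.

Import Order.TTheory GRing.Theory Num.Theory.
Local Open Scope ring_scope.

(** Identify the plane with the complex numbers and let [w] be the exponential
    of [i pi / n], so that the regular polygon is [P_j = r w^j].  Write a
    deformation as [V_j = f_j w^j]; antiperiodicity of [V] makes [f] periodic
    modulo [n].  With [g] the conjugate of [f] and [z = w^2], a primitive [n]-th
    root of unity, the two linear conditions have constant coefficients
    (lemma [chord_relation]), hence decouple under the discrete Fourier transform.
    The mode [q] obeys a 2 x 2 homogeneous system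
      [(a c - 1) F = (c - a) G],  [(b d - 1) F = (d - b) G],
    where [a = z], [b = z^k], [c = z^q], [d = z^(k q)].  The modes [0] and
    [-1] that survive for every [k] are the action of the traceless matrices, so
    rigidity follows once the determinant [resonance a b c d] is nonzero for all
    [2 <= q <= n - 2] (lemma [two_modes]).

    Put [u(x) = (x - 1) / (x + 1)], which is [i tan] of half the argument of
    [x].  The determinant vanishes exactly when [u(a) u(d) = u(b) u(c)], that is
      [tan(pi/n) tan(k q pi/n) = tan(k pi/n) tan(q pi/n)].
    A vanishing polynomial expression in [z] with integer coefficients still
    vanishes at every other primitive root of the same order, because cyclotomic
    polynomials are irreducible (lemma [root_primitive_conjugate]).  Comparing the
    equation with one or two well chosen conjugates settles it by algebra alone:

    - [n] odd, conjugate [z^2].  The double angle formula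
      [u(x^2) = 2 u(x) / (1 + u(x)^2)] turns the conjugate equation into
      [u(a)^2 + u(d)^2 = u(b)^2 + u(c)^2].  Two pairs with the same sum and
      product of squares agree, so [u(a)^2] is [u(b)^2] or [u(c)^2], and [k] or
      [q] is [1] or [-1] modulo [n]: impossible.
    - [4] divides [n], conjugate [- z].  As [u(- x) = 1 / u(x)], dividing the two
      equations gives [u(a)^2 = 1] or [u(a)^2 = u(c)^2], according to the parity
      of [q].  Both are impossible, so some tangent is zero or infinite, which
      the equations allow only for [n = 2 k] and [q] odd.
    - [n = 2 m] with [m] odd.  Then [y = - z] has odd order [m].  For [q] odd
      the equation reads [u(c) u(d) = u(a) u(b)] at [y], and the argument of
      the odd case yields [q = - k] or [q = k] modulo [m], with [k q] equal to
      [- 1] or [1]: up to replacing [q] by [n - q] this is the exceptional family.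
      For [q] even it reads [u(d) = u(a) u(b) u(c)]; comparing with [y^2] gives
      [A + B + C = 0] for [A = a + 1/a] and so on, and the same relation at [y^2]
      gives [A^2 + B^2 + C^2 = 6].  So [A], [B], [C] are the roots of a cubic
      [x^3 - 3 x - e]; together with the relation itself this says that [a^3], [b^3],
      [c^3] and [d] are equal up to inversion.  Then [a^9] is [a^3] or its inverse, so [m = 3], where the
      sum [A + B + C] does not vanish. *)

(** * Conjugate roots of unity *)

Lemma root_Cyclotomic (F : numFieldType) (n : nat) (z : F) :
  n.-primitive_root z -> root (map_poly intr 'Phi_n) z.
Proof.
move=> prim_z; have n_gt0 := prim_order_gt0 prim_z.
have root_Xn m : root (map_poly intr ('X^m - 1 : {poly int})) z = (z ^+ m == 1).
  by rewrite rmorphB rmorph1 /= map_polyXn rootE !hornerE subr_eq0.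
have: root (map_poly intr ('X^n - 1 : {poly int})) z.
  by rewrite root_Xn prim_expr_order.
rewrite -(prod_Cyclotomic n_gt0) rmorph_prod /= rootE horner_prod.
rewrite prodf_seq_eq0 => /hasP[d d_dv]; rewrite -dvdn_divisors // in d_dv.
move=> /= root_d; have d_gt0 := dvdn_gt0 n_gt0 d_dv.
suff zd1 : z ^+ d == 1.
  rewrite -(prim_order_dvd prim_z) in zd1.
  by have /eqP <- : d == n by rewrite eqn_dvd d_dv.
rewrite -root_Xn -(prod_Cyclotomic d_gt0) rmorph_prod /= rootE horner_prod.
rewrite prodf_seq_eq0; apply/hasP; exists d => //.
by rewrite -dvdn_divisors.
Qed.

(** The minimal polynomial over the rationals of any primitive [n]-th root of
    unity is the [n]-th cyclotomic polynomial.  It is known for algebraic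
    numbers, and a gcd computation over the rationals carries the resulting
    divisibility to the field [F], which is not assumed algebraic. *)
Lemma root_primitive_conjugate (F : numFieldType) (n t : nat) (z : F)
    (p : {poly int}) :
  n.-primitive_root z -> coprime t n ->
  root (map_poly intr p) z -> root (map_poly intr p) (z ^+ t).
Proof.
move=> prim_z co_tn pz0; have n_gt0 := prim_order_gt0 prim_z.
pose Phi : {poly rat} := map_poly intr 'Phi_n.
pose P : {poly rat} := map_poly intr p.
have via_rat (K : numFieldType) (q : {poly int}) :
    map_poly ratr (map_poly intr q : {poly rat}) = map_poly intr q :> {poly K}.
  by rewrite -map_poly_comp; apply: eq_map_poly => i /=; rewrite ratr_int.
have Phi_min (x : algC) :
    n.-primitive_root x -> forall q, root (map_poly ratr q) x = (Phi %| q).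
  move=> prim_x q; have [f [Df _ ->]] := minCpolyP x; congr (_ %| _).
  apply: (map_poly_inj (ratr : {rmorphism rat -> algC})).
  by rewrite -Df (minCpoly_cyclotomic prim_x) /Phi via_rat (Cintr_Cyclotomic prim_x).
have Phi_dvd_P : Phi %| P.
  have [x prim_x] := C_prim_root_exists n_gt0.
  pose d := gcdp Phi P.
  have [co_PhiP | nco] := boolP (coprimep Phi P).
    rewrite -(coprimep_map (ratr : {rmorphism rat -> F})) /= !via_rat in co_PhiP.
    have := coprimep_root co_PhiP (root_Cyclotomic prim_z).
    by rewrite -rootE pz0.
  (* A root of the nontrivial common divisor is again primitive, so its minimal
     polynomial, the cyclotomic one, divides the common divisor. *)
  have /closed_rootP[x' dx'] : size (map_poly ratr d : {poly algC}) != 1%N.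
    by rewrite size_map_poly.
  have prim_x' : n.-primitive_root x'.
    rewrite -(root_cyclotomic prim_x) -(Cintr_Cyclotomic prim_x) -via_rat.
    by apply: root_dvdp dx'; rewrite dvdp_map dvdp_gcdl.
  by rewrite (Phi_min _ prim_x') in dx'; apply: dvdp_trans dx' (dvdp_gcdr _ _).
rewrite -via_rat; apply: (@root_dvdp _ (map_poly ratr Phi)).
  by rewrite dvdp_map.
by rewrite via_rat root_Cyclotomic // prim_root_exp_coprime.
Qed.

(** * Multiplicative relations between tangents *)

(** The equation [u(a) u(d) = u(b) u(c)] with its denominators cleared, see
    [resonanceE].  In this form it is the determinant of the system satisfied by
    a Fourier mode, including when some tangent is infinite. *)
Definition resonance (A : comPzRingType) (a b c d : A) : A :=
  (a * c - 1) * (d - b) - (c - a) * (b * d - 1).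

(** The signs are there for the roots of order [2 m] with [m] odd, which are
    handled as opposites of roots of order [m]. *)
Lemma resonance_conjugate (F : numFieldType) (n t s1 s2 k q l : nat) (z : F) :
  n.-primitive_root z -> coprime t n ->
  resonance ((-1) ^+ s1 * z) (z ^+ k) ((-1) ^+ s2 * z ^+ q) (z ^+ l) = 0 ->
  resonance ((-1) ^+ s1 * z ^+ t) (z ^+ k ^+ t)
            ((-1) ^+ s2 * z ^+ q ^+ t) (z ^+ l ^+ t) = 0.
Proof.
move=> prim_z co_tn.
pose p : {poly int} := resonance ((-1) ^+ s1 * 'X) 'X^k ((-1) ^+ s2 * 'X^q) 'X^l.
have pE x : (map_poly intr p).[x] =
   resonance ((-1) ^+ s1 * x) (x ^+ k) ((-1) ^+ s2 * x ^+ q) (x ^+ l) :> F.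
  rewrite /p /resonance !(rmorphB, rmorphM, rmorphXn, rmorphN, rmorph1) /=.
  by rewrite map_polyX !(hornerE, horner_exp).
move=> /eqP; rewrite -pE -rootE => /(root_primitive_conjugate prim_z co_tn).
by rewrite rootE pE !(exprAC z t) => /eqP.
Qed.

Lemma resonanceE (A : comPzRingType) (a b c d : A) :
  2 * resonance a b c d =
  (a - 1) * (d - 1) * (b + 1) * (c + 1) - (b - 1) * (c - 1) * (a + 1) * (d + 1).
Proof. by rewrite /resonance; ring. Qed.

(** By the double angle formula the two relations say that the pairs
    [(u(a)^2, u(d)^2)] and [(u(b)^2, u(c)^2)] have the same sum and the same
    product, so they are the same up to order; and [u(x)^2 = u(y)^2] means that
    [x] is [y] or its inverse. *)
Lemma resonance_squares (F : numFieldType) (a b c d : F) :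
  a + 1 != 0 -> b + 1 != 0 -> c + 1 != 0 -> d + 1 != 0 ->
  b - 1 != 0 -> c - 1 != 0 ->
  resonance a b c d = 0 -> resonance (a ^+ 2) (b ^+ 2) (c ^+ 2) (d ^+ 2) = 0 ->
  [|| a == b, a * b == 1, a == c | a * c == 1].
Proof.
move=> a1 b1 c1 d1 nb nc E1 E2.
pose u x : F := (x - 1) / (x + 1).
have us : u a * u d = u b * u c.
  apply/eqP; rewrite -subr_eq0; apply/eqP.
  transitivity (2 * resonance a b c d / ((a + 1) * (b + 1) * (c + 1) * (d + 1))).
    by rewrite resonanceE /u; field; rewrite a1 b1 c1 d1.
  by rewrite E1 mulr0 mul0r.
have us2 : u a * u d * ((1 + u b ^+ 2) * (1 + u c ^+ 2)) =
           u b * u c * ((1 + u a ^+ 2) * (1 + u d ^+ 2)).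
  apply/eqP; rewrite -subr_eq0; apply/eqP.
  transitivity (8 * resonance (a ^+ 2) (b ^+ 2) (c ^+ 2) (d ^+ 2) /
     ((a + 1) * (b + 1) * (c + 1) * (d + 1)) ^+ 2).
    have -> (x : F) : 8 * x = 4 * (2 * x) by ring.
    by rewrite resonanceE /u; field; rewrite a1 b1 c1 d1.
  by rewrite E2 mulr0 mul0r.
have usn0 : u b * u c != 0 by rewrite !mulf_neq0 ?invr_eq0.
rewrite us in us2; move/(mulfI usn0): us2 => sumE.
(* [u a ^+ 2] is a root of the monic quadratic with roots [u b ^+ 2], [u c ^+ 2]. *)
have : (u a ^+ 2 - u b ^+ 2) * (u a ^+ 2 - u c ^+ 2) = 0.
  transitivity (u a ^+ 2 * ((1 + u a ^+ 2) * (1 + u d ^+ 2)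
                            - (1 + u b ^+ 2) * (1 + u c ^+ 2))
    - (1 + u a ^+ 2) * ((u a * u d) ^+ 2 - (u b * u c) ^+ 2)); first by ring.
  by rewrite sumE us !subrr !mulr0 subrr.
have tanB x y : x + 1 != 0 -> y + 1 != 0 ->
    u x ^+ 2 - u y ^+ 2 = 4 * ((x - y) * (x * y - 1)) / ((x + 1) * (y + 1)) ^+ 2.
  by move=> x1 y1; rewrite /u; field; rewrite x1 y1.
move/eqP; rewrite !tanB // !(mulf_eq0, invr_eq0, expf_eq0) (negPf a1) (negPf b1).
by rewrite (negPf c1) pnatr_eq0 !subr_eq0 /= !orbF -!orbA.
Qed.

(** Negating the root of unity inverts its tangent: [u(- a) = 1 / u(a)]. *)
Lemma resonance_opp_tan (F : numFieldType) (a b c d : F) :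
  let u x := (x - 1) / (x + 1) in
  a + 1 != 0 -> b + 1 != 0 -> c + 1 != 0 -> d + 1 != 0 ->
  resonance (- a) b c d = 0 -> u d = u a * u b * u c.
Proof.
move=> u a1 b1 c1 d1 E1; apply/eqP; rewrite -subr_eq0; apply/eqP.
transitivity (- (2 * resonance (- a) b c d)
                / ((a + 1) * (b + 1) * (c + 1) * (d + 1))).
  by rewrite resonanceE /u; field; rewrite a1 b1 c1 d1.
by rewrite E1 mulr0 oppr0 mul0r.
Qed.

(** Substituting [u(d) = u(a) u(b) u(c)] in the double angle formulas leaves
    [(1 + u(a)^2) (1 + u(b)^2) (1 + u(c)^2) = 4 (1 + (u(a) u(b) u(c))^2)].
    Expressed in the cosines, the half sums of [x] and [1/x], only the linear
    terms of this equation survive. *)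
Lemma resonance_opp_squares (F : numFieldType) (a b c d : F) :
  a - 1 != 0 -> b - 1 != 0 -> c - 1 != 0 ->
  a + 1 != 0 -> b + 1 != 0 -> c + 1 != 0 -> d + 1 != 0 ->
  a != 0 -> b != 0 -> c != 0 ->
  resonance (- a) b c d = 0 ->
  resonance (- a ^+ 2) (b ^+ 2) (c ^+ 2) (d ^+ 2) = 0 ->
  (a + a^-1) + (b + b^-1) + (c + c^-1) = 0.
Proof.
move=> na nb nc a1 b1 c1 d1 a0 b0 c0 E1 E2.
pose u x : F := (x - 1) / (x + 1).
have s_uvw : u d = u a * u b * u c := resonance_opp_tan a1 b1 c1 d1 E1.
have s2 : u d * ((1 + u a ^+ 2) * (1 + u b ^+ 2) * (1 + u c ^+ 2)) =
          u a * u b * u c * (4 * (1 + u d ^+ 2)).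
  apply/eqP; rewrite -subr_eq0; apply/eqP.
  transitivity (- 8 * (2 * resonance (- a ^+ 2) (b ^+ 2) (c ^+ 2) (d ^+ 2)) /
     ((a + 1) * (b + 1) * (c + 1) * (d + 1)) ^+ 2).
    by rewrite resonanceE /u; field; rewrite a1 b1 c1 d1.
  by rewrite E2 !mulr0 mul0r.
have un0 : u a * u b * u c != 0 by rewrite !mulf_neq0 ?invr_eq0.
rewrite s_uvw in s2; move/(mulfI un0): s2 => s2.
transitivity ((4 * (1 + (u a * u b * u c) ^+ 2)
    - (1 + u a ^+ 2) * (1 + u b ^+ 2) * (1 + u c ^+ 2))
    * ((a + 1) * (b + 1) * (c + 1)) ^+ 2 / (32 * (a * b * c))); last first.
  by rewrite s2 subrr !mul0r.
by rewrite /u; field; rewrite a0 b0 c0 a1 b1 c1.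
Qed.

(** With [T x = x + 1/x], the first two elementary symmetric functions of
    [T a], [T b], [T c] are [0] and [- 3], so these are the roots of
    [x^3 - 3 x - e]; and [T x ^ 3 - 3 T x] is [T (x ^ 3)].  That [T d] is [e] too
    follows from [u(x)^2 = (T x - 2) / (T x + 2)], which makes the square of the
    relation between tangents an identity on the values of the cubic at
    [2] and [- 2]. *)
Lemma cubes_of_null_cosines (F : numFieldType) (a b c d : F) :
  a != 0 -> b != 0 -> c != 0 -> d != 0 ->
  a + 1 != 0 -> b + 1 != 0 -> c + 1 != 0 -> d + 1 != 0 ->
  (a + a^-1) + (b + b^-1) + (c + c^-1) = 0 ->
  (a ^+ 2 + (a ^+ 2)^-1) + (b ^+ 2 + (b ^+ 2)^-1) + (c ^+ 2 + (c ^+ 2)^-1) = 0 ->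
  resonance (- a) b c d = 0 ->
  [/\ a ^+ 3 + (a ^+ 3)^-1 = d + d^-1, b ^+ 3 + (b ^+ 3)^-1 = d + d^-1
     & c ^+ 3 + (c ^+ 3)^-1 = d + d^-1].
Proof.
move=> a0 b0 c0 d0 a1 b1 c1 d1.
pose u x : F := (x - 1) / (x + 1); pose T (x : F) := x + x^-1.
rewrite -!/(T _) => e1 p2 E1.
have T2 x : x != 0 -> T (x ^+ 2) = T x ^+ 2 - 2 by move=> x0; rewrite /T; field.
have T3 x : x != 0 -> T (x ^+ 3) = T x ^+ 3 - 3 * T x.
  by move=> x0; rewrite /T; field.
have uu x : x != 0 -> x + 1 != 0 ->
    u x ^+ 2 = (T x - 2) / (T x + 2) /\ T x + 2 != 0.
  move=> x0 x1; have Tx2 : T x + 2 = (x + 1) ^+ 2 / x by rewrite /T; field.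
  have Tx2n0 : T x + 2 != 0 by rewrite Tx2 mulf_neq0 ?expf_neq0 ?invr_eq0.
  by split=> //; rewrite Tx2 /T /u; field; rewrite x0 x1.
rewrite !T2 // in p2.
have e2 : T a * T b + T b * T c + T a * T c = -3.
  have : (T a + T b + T c) ^+ 2 - (T a ^+ 2 - 2 + (T b ^+ 2 - 2) + (T c ^+ 2 - 2))
         = 2 * (T a * T b + T b * T c + T a * T c) + 6 by ring.
  rewrite e1 p2 expr0n subr0 /= => /esym/eqP; rewrite addr_eq0 => /eqP h.
  apply: (@mulfI _ 2); rewrite ?pnatr_eq0 // h; ring.
have cubic x : (x - T a) * (x - T b) * (x - T c) = x ^+ 3 - 3 * x - T a * T b * T c.
  transitivity (x ^+ 3 - (T a + T b + T c) * x ^+ 2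
     + (T a * T b + T b * T c + T a * T c) * x - T a * T b * T c); first by ring.
  by rewrite e1 e2; ring.
have root3 x : (x - T a) * (x - T b) * (x - T c) = 0 -> x ^+ 3 - 3 * x = T a * T b * T c.
  by rewrite cubic => /eqP; rewrite subr_eq0 => /eqP.
suff Dd : T d = T a * T b * T c.
  by rewrite Dd !T3 //; split; apply: root3; rewrite subrr ?(mulr0, mul0r).
have : u d ^+ 2 = u a ^+ 2 * u b ^+ 2 * u c ^+ 2.
  by rewrite -!exprMn; congr (_ ^+ 2); apply: resonance_opp_tan.
have [ua A2] := uu a a0 a1; have [ub B2] := uu b b0 b1.
have [uc C2] := uu c c0 c1; have [ud D2] := uu d d0 d1.
rewrite ua ub uc ud.
have cubP := cubic (-2); have cubM := cubic 2.
set e := T a * T b * T c in cubP cubM *.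
have numE : (T a - 2) * (T b - 2) * (T c - 2) = e - 2.
  by transitivity (- ((2 - T a) * (2 - T b) * (2 - T c))); [ring|rewrite cubM; ring].
have denE : (T a + 2) * (T b + 2) * (T c + 2) = e + 2.
  by transitivity (- ((-2 - T a) * (-2 - T b) * (-2 - T c))); [ring|rewrite cubP; ring].
have e2n0 : e + 2 != 0 by rewrite -denE !mulf_neq0.
have -> : (T a - 2) / (T a + 2) * ((T b - 2) / (T b + 2)) * ((T c - 2) / (T c + 2))
   = (e - 2) / (e + 2) by rewrite -numE -denE; field; rewrite A2 B2 C2.
move/eqP; rewrite eqr_div // => /eqP h.
apply: (@mulfI _ 4); rewrite ?pnatr_eq0 //.
apply/eqP; rewrite -subr_eq0; apply/eqP.
transitivity ((T d - 2) * (e + 2) - (e - 2) * (T d + 2)); first by ring.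
by rewrite h subrr.
Qed.

(** * Nonvanishing of the determinant of a Fourier mode *)

Lemma prim_root_sub1_eq0 (F : numFieldType) (n i : nat) (z : F) :
  n.-primitive_root z -> (z ^+ i - 1 == 0) = (n %| i)%N.
Proof. by move=> prim_z; rewrite subr_eq0 -(prim_order_dvd prim_z). Qed.

Lemma prim_root_neq0 (F : numFieldType) (n : nat) (z : F) :
  n.-primitive_root z -> z != 0.
Proof.
move=> prim_z; apply: contra_eq_neq (prim_expr_order prim_z) => ->.
by rewrite expr0n gtn_eqF ?(prim_order_gt0 prim_z) // eq_sym oner_eq0.
Qed.

Lemma prim_root_mul_eq1 (F : numFieldType) (n i j : nat) (z : F) :
  n.-primitive_root z -> (z ^+ i * z ^+ j == 1) = (n %| i + j)%N.
Proof. by move=> prim_z; rewrite -exprD -(prim_order_dvd prim_z). Qed.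

Lemma odd_prim_root_add1_neq0 (F : numFieldType) (n i : nat) (z : F) :
  n.-primitive_root z -> odd n -> z ^+ i + 1 != 0.
Proof.
move=> prim_z odd_n; rewrite addr_eq0; apply/eqP => zi.
have : z ^+ (i * 2) == 1 by rewrite exprM zi sqrrN expr1n.
rewrite -(prim_order_dvd prim_z) Gauss_dvdl ?coprimen2 //.
rewrite (prim_order_dvd prim_z) zi => /eqP/esym/eqP.
by rewrite -addr_eq0 (pnatr_eq0 _ 2).
Qed.

Lemma resonance_odd_neq0 (F : numFieldType) (n k q : nat) (z : F) :
  n.-primitive_root z -> odd n -> (2 <= k)%N -> (2 * k <= n)%N ->
  (2 <= q)%N -> (q <= n - 2)%N ->
  resonance z (z ^+ k) (z ^+ q) (z ^+ (k * q)) != 0.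
Proof.
move=> prim_z odd_n k2 kn q2 qn; apply/eqP => E1.
have E2 : resonance (z ^+ 2) (z ^+ k ^+ 2) (z ^+ q ^+ 2) (z ^+ (k * q) ^+ 2) = 0.
  have := @resonance_conjugate F n 2 0 0 k q (k * q) z prim_z.
  by rewrite !expr0 !mul1r coprime2n; apply.
have zN i := odd_prim_root_add1_neq0 i prim_z odd_n.
have nk : ~~ (n %| k)%N by rewrite gtnNdvd //; lia.
have nq : ~~ (n %| q)%N by rewrite gtnNdvd //; lia.
have := resonance_squares (zN 1) (zN k) (zN q) (zN (k * q)%N) _ _ E1 E2.
rewrite !(prim_root_sub1_eq0 _ prim_z) => /(_ nk nq).
rewrite !(eq_prim_root_expr prim_z 1) !(prim_root_mul_eq1 1 _ prim_z).
rewrite !modn_small; try lia.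
rewrite !gtnNdvd; lia.
Qed.

Lemma prim_root_half (F : numFieldType) (h : nat) (z : F) :
  (2 * h).-primitive_root z -> z ^+ h = -1.
Proof.
move=> prim_z; have := prim_order_gt0 prim_z => h_gt0.
have /eqP := prim_expr_order prim_z; rewrite mulnC exprM -subr_eq0 subr_sqr_1.
rewrite mulf_eq0 (prim_root_sub1_eq0 _ prim_z) gtnNdvd /=; try lia.
by rewrite addr_eq0 => /eqP.
Qed.

(** The exponent [h + 1] is a unit modulo [2 h] and raising to it negates [z].
    The terms of the determinant kept by this conjugation and those that change
    sign therefore vanish separately.  For [q] odd each of the two parts factors;
    for [q] even, combinations of the two do. *)
Lemma resonance_4dvd_neq0 (F : numFieldType) (h k q : nat) (z : F) :
  (2 * h).-primitive_root z -> ~~ odd h -> ~~ odd k -> (2 <= k)%N -> (k <= h)%N ->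
  (2 <= q)%N -> (q <= 2 * h - 2)%N -> (k = h -> ~~ odd q) ->
  resonance z (z ^+ k) (z ^+ q) (z ^+ (k * q)) != 0.
Proof.
move=> prim_z even_h even_k k2 kn q2 qn khq; apply/eqP => E1.
have zh := prim_root_half prim_z.
have conj_pow i : z ^+ i ^+ h.+1 = (-1) ^+ (odd i) * z ^+ i.
  by rewrite exprAC exprS zh mulrN1 signr_odd [LHS]exprNn.
have co : coprime h.+1 (2 * h).
  by rewrite coprimeMr coprimen2 /= even_h coprimeSn.
have E2 : resonance (- z) (z ^+ k) ((-1) ^+ odd q * z ^+ q) (z ^+ (k * q)) = 0.
  have := @resonance_conjugate F _ h.+1 0 0 k q (k * q) z prim_z co.
  rewrite !expr0 !mul1r (conj_pow k) (conj_pow q) (conj_pow (k * q)%N).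
  by rewrite oddM (negPf even_k) /= !mul1r exprS zh mulrN1; apply.
have z0 := prim_root_neq0 prim_z.
have ndvd i : (0 < i)%N -> (i < 2 * h)%N -> z ^+ i - 1 != 0.
  by move=> i0 i1; rewrite (prim_root_sub1_eq0 _ prim_z) gtnNdvd.
have nb : z ^+ k - 1 != 0 by apply: ndvd; lia.
have nc : z ^+ q - 1 != 0 by apply: ndvd; lia.
have b1P : z ^+ k + 1 = 0 -> k = h.
  move/eqP; rewrite addr_eq0 -zh (eq_prim_root_expr prim_z) !modn_small; lia.
have c1P : z ^+ q + 1 = 0 -> q = h.
  move/eqP; rewrite addr_eq0 -zh (eq_prim_root_expr prim_z) !modn_small; lia.
have dE : z ^+ (k * q) = (z ^+ k) ^+ q by rewrite exprM.
have dE' : z ^+ (k * q) = (z ^+ q) ^+ k by rewrite mulnC exprM.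
case: (boolP (odd q)) E2 => odd_q E2; rewrite ?expr1 ?mulN1r ?expr0 ?mul1r in E2.
- have ac : (z * z ^+ q - 1) * (z ^+ (k * q) - z ^+ k) = 0.
    apply: (@mulfI _ 2); rewrite ?pnatr_eq0 // mulr0.
    by rewrite -[RHS]addr0 -{1}E1 -E2 /resonance; ring.
  have ca : (z ^+ q - z) * (z ^+ k * z ^+ (k * q) - 1) = 0.
    apply: (@mulfI _ 2); rewrite ?pnatr_eq0 // mulr0.
    by rewrite -[RHS]subr0 -{1}E2 -E1 /resonance; ring.
  move/eqP: ac; rewrite mulf_eq0 -exprS (prim_root_sub1_eq0 _ prim_z) gtnNdvd; try lia.
  rewrite /= subr_eq0 => /eqP db; move/eqP: ca.
  rewrite mulf_eq0 subr_eq0 -{2}[z]expr1 (eq_prim_root_expr prim_z) !modn_small; try lia.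
  case/orP => [|]; first by lia.
  rewrite db -expr2 subr_sqr_1 mulf_eq0 (negPf nb) /= => /eqP/b1P /khq.
  by rewrite odd_q.
- have XY : z ^+ (k * q) * z ^+ k + z ^+ (k * q) * z ^+ q = 1 + z ^+ k * z ^+ q.
    apply: (@mulfI _ (2 * z)); rewrite ?mulf_neq0 ?pnatr_eq0 //.
    apply/eqP; rewrite -subr_eq0 -[X in _ == X](subrr 0) -{1}E1 -E2 /resonance.
    by apply/eqP; ring.
  have Y : z ^+ k + z ^+ q = z ^+ (k * q) * (1 + z ^+ k * z ^+ q).
    apply: (@mulfI _ 2); rewrite ?pnatr_eq0 //.
    apply/eqP; rewrite -subr_eq0 -[X in _ == X](addr0 0) -{1}E1 -E2 /resonance.
    by apply/eqP; ring.
  (* Once the unit [z] is divided out of the odd part, its difference and sum with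
     the even part factor as in the next two products. *)
  have : (z ^+ (k * q) + 1) * ((z ^+ k - 1) * (z ^+ q - 1)) = 0.
    transitivity (z ^+ (k * q) * (1 + z ^+ k * z ^+ q) - (z ^+ k + z ^+ q)
      + (1 + z ^+ k * z ^+ q) - (z ^+ (k * q) * z ^+ k + z ^+ (k * q) * z ^+ q)).
      by ring.
    by rewrite Y XY; ring.
  move/eqP; rewrite !mulf_eq0 (negPf nb) (negPf nc) !orbF => dN1.
  have dN : z ^+ (k * q) != 1.
    by apply: contraTneq dN1 => ->; rewrite (pnatr_eq0 _ 2).
  have : (z ^+ (k * q) - 1) * ((z ^+ k + 1) * (z ^+ q + 1)) = 0.
    transitivity (z ^+ (k * q) * (1 + z ^+ k * z ^+ q) - (z ^+ k + z ^+ q)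
      - (1 + z ^+ k * z ^+ q) + (z ^+ (k * q) * z ^+ k + z ^+ (k * q) * z ^+ q)).
      by ring.
    by rewrite Y XY; ring.
  move/eqP; rewrite !mulf_eq0 subr_eq0 (negPf dN) /=.
  case/orP=> /eqP; [move/b1P => eqh | move/c1P => eqh]; case/eqP: dN.
    by rewrite dE eqh zh -signr_odd (negPf odd_q).
  by rewrite dE' eqh zh -signr_odd (negPf even_k).
Qed.

Lemma mul_pred (k j : nat) : (0 < k)%N -> (0 < j)%N ->
  ((k - 1) * (j - 1) = k * j + 1 - (k + j))%N.
Proof. by case: k j => [//|k] [//|j] _ _; rewrite !(mulnS, mulSn); lia. Qed.

(** For [q = k + m] and [j = 2 m - q], this turns [k q = 1] modulo [m] into
    [k j = - 1]. *)
Lemma mul_sub_reflect (k m : nat) : (0 < k)%N -> (k <= m)%N ->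
  (k * (2 * m) - (k * (k + m) - 1) = k * (m - k) + 1)%N.
Proof.
move=> k0 km; rewrite mulnDr mulnBr mulnCA.
by have := leq_mul (leqnn k) km; have := leq_mul k0 k0; lia.
Qed.

(** After the swap [resonance (- a) b (- c) d = resonance c a b d] this is the
    situation of [resonance_squares].  Parity excludes [y^q = y] and
    [y^q y = 1]; the two other outcomes give the exceptional [j], as [m - k]
    and as [q] respectively. *)
Lemma resonance_opp_odd_mode (F : numFieldType) (m k q : nat) (y : F) :
  m.-primitive_root y -> odd m -> ~~ odd k -> odd q -> (2 <= k)%N -> (k <= m)%N ->
  (2 <= q)%N -> (q <= 2 * m - 2)%N ->
  resonance (- y) (y ^+ k) (- y ^+ q) (y ^+ (k * q)) = 0 ->
  exists j : nat, [/\ (2 <= j)%N, (j <= 2 * m - 2)%N, m = (k + j)%N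
         & (2 * m %| (k - 1) * (j - 1))%N].
Proof.
move=> prim_y odd_m even_k odd_q k2 km q2 qm E1.
have yN i := odd_prim_root_add1_neq0 i prim_y odd_m.
have E2 : resonance (- y ^+ 2) (y ^+ k ^+ 2) (- y ^+ q ^+ 2) (y ^+ (k * q) ^+ 2) = 0.
  have := @resonance_conjugate F m 2 1 1 k q (k * q) y prim_y.
  by rewrite !expr1 !mulN1r coprime2n; apply.
have swap (a b c d : F) : resonance (- a) b (- c) d = resonance c a b d.
  by rewrite /resonance; ring.
rewrite !swap in E1 E2.
have lt_km : (k < m)%N by rewrite ltn_neqAle km andbT; apply: contraNneq even_k => ->.
have y1 : y - 1 != 0 by rewrite -[y]expr1 (prim_root_sub1_eq0 _ prim_y) gtnNdvd; lia.
have yk1 : y ^+ k - 1 != 0 by rewrite (prim_root_sub1_eq0 _ prim_y) gtnNdvd; lia.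
have yk0 : y ^+ k + 1 != 0 := yN k.
have := resonance_squares (yN q) (yN 1) (yN k) (yN (k * q)%N) y1 yk1 E1 E2.
have dvd_lt3m i : (m %| i)%N -> (i < 3 * m)%N -> i \in [:: 0; m; 2 * m]%N.
  by case/dvdnP => [[|[|[|c]]]] -> ltc; rewrite !inE; nia.
have kq_dvd j : (m %| k * j + 1)%N -> odd j -> m = (k + j)%N ->
    (2 * m %| (k - 1) * (j - 1))%N.
  move=> dv odd_j mE; rewrite Gauss_dvd ?coprime2n //; apply/andP; split.
    by rewrite dvdn2 oddM negb_and oddB ?odd_j ?orbT //; lia.
  by rewrite mul_pred // ?dvdn_sub -?mE //; lia.
case/or4P.
- rewrite -{2}[y]expr1 (eq_prim_root_expr prim_y) eqn_mod_dvd; last by lia.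
  by move/dvd_lt3m => /(_ ltac:(lia)); rewrite !inE; lia.
- rewrite -{2}[y]expr1 (prim_root_mul_eq1 _ _ prim_y).
  by move/dvd_lt3m => /(_ ltac:(lia)); rewrite !inE; lia.
- move=> /[dup] /eqP yqk; rewrite (eq_prim_root_expr prim_y) => qk_mod.
  have le_kq : (k <= q)%N.
    rewrite leqNgt; apply/negP => lt_qk; move: qk_mod.
    rewrite eq_sym eqn_mod_dvd ?(ltnW lt_qk) //.
    by move/dvd_lt3m => /(_ ltac:(lia)); rewrite !inE; lia.
  have qE : q = (k + m)%N.
    move: qk_mod; rewrite eqn_mod_dvd //.
    by move/dvd_lt3m => /(_ ltac:(lia)); rewrite !inE; lia.
  move/eqP: E1; rewrite yqk /resonance subrr mul0r subr0 mulf_eq0.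
  rewrite -expr2 subr_sqr_1 mulf_eq0 (negPf yk1) (negPf yk0) /= subr_eq0.
  rewrite -{2}[y]expr1 (eq_prim_root_expr prim_y) eqn_mod_dvd; last first.
    by rewrite muln_gt0; lia.
  move=> dv; exists (m - k)%N.
  split; [clear -qE qm k2; lia | lia | clear -km; lia | apply: kq_dvd; last first].
  - by rewrite subnKC.
  - by rewrite oddB // (negPf even_k) odd_m.
  have : (m %| k * (2 * m) - (k * q - 1))%N.
    by rewrite dvdn_sub // mulnA dvdn_mull.
  by rewrite qE mul_sub_reflect //; lia.
- rewrite (prim_root_mul_eq1 _ _ prim_y).
  move/dvd_lt3m => /(_ ltac:(lia)); rewrite !inE => qkE.
  have {qkE} mE : m = (k + q)%N by lia.
  have yqk : y ^+ q * y ^+ k = 1.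
    by apply/eqP; rewrite (prim_root_mul_eq1 _ _ prim_y) mE addnC.
  move/eqP: E1; rewrite /resonance yqk subrr mul0r sub0r oppr_eq0 mulf_eq0.
  case/orP=> [|]; rewrite subr_eq0.
    move=> /eqP yk_yq; move: yqk; rewrite -yk_yq => /eqP.
    by rewrite -subr_eq0 -expr2 subr_sqr_1 mulf_eq0 (negPf yk1) (negPf yk0).
  rewrite -{1}[y]expr1 (prim_root_mul_eq1 _ _ prim_y) addnC => dv.
  by exists q; split=> //; apply: kq_dvd.
Qed.

Lemma sum_inv_inj (F : fieldType) (x w : F) :
  x != 0 -> w != 0 -> x + x^-1 = w + w^-1 -> x = w \/ x * w = 1.
Proof.
move=> x0 w0 h; have : (x - w) * (x * w - 1) = 0.
  transitivity (x * w * (x + x^-1 - (w + w^-1))); first by field; rewrite ?x0 ?w0.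
  by rewrite h subrr mulr0.
move/eqP; rewrite mulf_eq0 !subr_eq0 => /orP[] /eqP; [left|right] => //.
Qed.

Lemma sum_inv_expr (F : fieldType) (x w : F) (n : nat) :
  x != 0 -> w != 0 -> x + x^-1 = w + w^-1 ->
  x ^+ n + (x ^+ n)^-1 = w ^+ n + (w ^+ n)^-1.
Proof.
move=> x0 w0 /(sum_inv_inj x0 w0)[-> //|/(canRL (mulfK w0))].
by rewrite mul1r => ->; rewrite exprVn invrK addrC.
Qed.

(** Write [x ~ w] when [x] is [w] or its inverse.  By [cubes_of_null_cosines],
    [a^3 ~ b^3 ~ c^3 ~ d] with [a = y], [b = a^k], [c = a^q], [d = b^q].  Hence
    [a^9 ~ d^3 = (b^3)^q ~ (a^3)^q = c^3 ~ a^3], so the odd number [m] divides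
    [6] or [12]. *)
Lemma resonance_opp_even_mode_neq0 (F : numFieldType) (m k q : nat) (y : F) :
  m.-primitive_root y -> odd m -> ~~ odd k -> ~~ odd q -> (2 <= k)%N -> (k <= m)%N ->
  (2 <= q)%N -> (q <= 2 * m - 2)%N ->
  resonance (- y) (y ^+ k) (y ^+ q) (y ^+ (k * q)) != 0.
Proof.
move=> prim_y odd_m even_k even_q k2 km q2 qm; apply/eqP => E1.
have yN i := odd_prim_root_add1_neq0 i prim_y odd_m.
have conj2 t : coprime t m ->
   resonance (- y ^+ t) (y ^+ k ^+ t) (y ^+ q ^+ t) (y ^+ (k * q) ^+ t) = 0.
  move=> co; have := @resonance_conjugate F m t 1 0 k q (k * q) y prim_y co.
  by rewrite expr0 expr1 !mulN1r !mul1r; apply.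
have lt_km : (k < m)%N by rewrite ltn_neqAle km andbT; apply: contraNneq even_k => ->.
have y0 := prim_root_neq0 prim_y.
have cop i : coprime (2 ^ i) m by rewrite coprimeXl ?coprime2n.
have nd t i : coprime t m -> ~~ (m %| i)%N -> y ^+ i ^+ t - 1 != 0.
  move=> co ni; rewrite -exprM (prim_root_sub1_eq0 _ prim_y) mulnC Gauss_dvdr //.
  by rewrite coprime_sym.
have dk : ~~ (m %| k)%N by rewrite gtnNdvd //; lia.
have dq : ~~ (m %| q)%N.
  apply/negP => /dvdnP[[|[|c]] qE]; [lia| |nia].
  by move: even_q; rewrite qE mul1n odd_m.
have d1 : ~~ (m %| 1)%N by rewrite gtnNdvd //; lia.
have sum0 t : coprime t m ->
   y ^+ t + (y ^+ t)^-1 + (y ^+ k ^+ t + (y ^+ k ^+ t)^-1)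
   + (y ^+ q ^+ t + (y ^+ q ^+ t)^-1) = 0.
  move=> co; have co2 : coprime (t * 2) m by rewrite coprimeMl co coprime2n.
  have yt i : y ^+ i ^+ t + 1 != 0 by rewrite -exprM.
  apply: (@resonance_opp_squares _ _ _ _ (y ^+ (k * q) ^+ t)); rewrite ?expf_neq0 ?nd //.
  - by have := nd t 1%N co d1; rewrite expr1.
  - exact: conj2.
  - by have := conj2 _ co2; rewrite !(exprM _ t).
have := @cubes_of_null_cosines F y (y ^+ k) (y ^+ q) (y ^+ (k * q)).
have yp1 : y + 1 != 0 := yN 1%N.
rewrite !expf_neq0 // !yN => /(_ y0 isT isT isT yp1 isT isT isT).
case.
- exact: (sum0 1%N (coprime1n _)).
- by apply: (sum0 2%N); rewrite coprime2n.
- exact: E1.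
move=> a3 b3 c3.
have y93 : y ^+ 9 + (y ^+ 9)^-1 = y ^+ 3 + (y ^+ 3)^-1.
  rewrite (exprM y 3 3) (sum_inv_expr 3 _ _ a3) ?expf_neq0 //.
  rewrite (exprM y k q) (exprAC _ q 3).
  rewrite (sum_inv_expr q _ _ (etrans b3 (esym a3))) ?expf_neq0 //.
  by rewrite (exprAC _ 3 q) c3 a3.
have m3 : m = 3%N.
  suff dv : (m %| 3)%N.
    by have := dvdn_leq (isT : 0 < 3)%N dv; move: k2 lt_km; clear; lia.
  have co4 : coprime m 4 by rewrite coprime_sym (cop 2%N).
  have [y9 | y9] := sum_inv_inj (expf_neq0 9 y0) (expf_neq0 3 y0) y93.
    move/eqP: y9; rewrite (eq_prim_root_expr prim_y) eqn_mod_dvd //.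
    by rewrite -(@Gauss_dvdl m 3 2) // coprimen2.
  move/eqP: y9; rewrite (prim_root_mul_eq1 _ _ prim_y).
  by rewrite (Gauss_dvdl 3 co4).
(* For [m = 3] the three cosines coincide and are nonzero. *)
have kE : k = 2%N by lia.
have := sum0 1%N (coprime1n _); rewrite !expr1 kE.
have y3 : y ^+ 3 = 1 by rewrite -m3 (prim_expr_order prim_y).
have yV : y^-1 = y ^+ 2.
  by apply: (mulfI y0); rewrite divff // -exprS.
have -> : y ^+ q + y ^- q = y + y^-1.
  have [->|->] : q = 2%N \/ q = 4%N by lia.
    by rewrite -yV invrK addrC.
  by rewrite (exprS y 3) y3 mulr1.
rewrite -yV invrK [y^-1 + y]addrC => h.
have : y ^+ 2 + 1 = 0.
  transitivity (y * (y + y^-1 + (y + y^-1) + (y + y^-1)) / 3); first by field.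
  by rewrite h mulr0 mul0r.
by move/eqP; rewrite (negPf (yN 2)).
Qed.

Lemma resonance_neq0 (F : numFieldType) (n k q : nat) (z : F) :
  n.-primitive_root z -> (2 <= k)%N -> (2 * k <= n)%N ->
  (2 <= q)%N -> (q <= n - 2)%N ->
  ~ (~~ odd n /\ odd k) ->
  ~ [/\ n = (2 * k)%N, ~~ odd k & (2 < k)%N] ->
  ~ (exists j : nat, [/\ (2 <= j)%N, (j <= n - 2)%N, n = (2 * (k + j))%N
         & (n %| (k - 1) * (j - 1))%N]) ->
  resonance z (z ^+ k) (z ^+ q) (z ^+ (k * q)) != 0.
Proof.
move=> prim_z k2 kn q2 qn not1 not2 not3.
have [odd_n | even_n] := boolP (odd n); first exact: resonance_odd_neq0 odd_n _ _ _ _.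
have even_k : ~~ odd k by apply/negP => odd_k; apply: not1.
have nE : n = (2 * n./2)%N by rewrite mul2n even_halfK.
move: n./2 nE => h nE; subst n; rewrite leq_pmul2l // in kn.
have [odd_h | even_h] := boolP (odd h); last first.
  apply: (resonance_4dvd_neq0 prim_z) => // kh; apply/negP => odd_q; apply: not2.
  by split; rewrite ?kh //; lia.
pose y := - z.
have zN : z = - y by rewrite opprK.
have prim_y : h.-primitive_root y.
  have dvd2 : (2 %| h.+1)%N by rewrite dvdn2 /= odd_h.
  have -> : y = (z ^+ 2) ^+ (h.+1 %/ 2).
    by rewrite -exprM mulnC divnK // exprS (prim_root_half prim_z) mulrN1.
  have h_gt0 : (0 < h)%N := odd_gt0 odd_h.
  rewrite prim_root_exp_coprime ?(coprime_dvdl (dvdn_div dvd2)) ?coprimeSn //.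
  have := dvdn_prim_root prim_z (dvdn_mull 2 (dvdnn h)).
  by rewrite mulnK.
have zpow i : z ^+ i = (-1) ^+ odd i * y ^+ i.
  by rewrite zN [LHS]exprNn signr_odd.
rewrite (zpow k) (zpow q) (zpow (k * q)%N) oddM (negPf even_k) /= !mul1r zN.
have [odd_q | even_q] := boolP (odd q).
  rewrite mulN1r; apply/eqP => /(resonance_opp_odd_mode prim_y odd_h even_k odd_q k2 kn q2 qn).
  by case=> j [j2 jn hE dv]; apply: not3; exists j; split; rewrite -?hE.
by rewrite mul1r; apply: (resonance_opp_even_mode_neq0 prim_y).
Qed.

(** * Discrete Fourier transform of periodic sequences *)

(** A shift by one replaces the term [h 0] by the equal term [h n]. *)
Lemma sum_period_shift (A : zmodType) (n : nat) (h : int -> A) (m : int) :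
  (forall j, h (j + n%:Z) = h j) -> \sum_(j < n) h (j%:Z + m) = \sum_(j < n) h j.
Proof.
have shift_nat (g : int -> A) (l : nat) : (forall j, g (j + n%:Z) = g j) ->
    \sum_(j < n) g (j%:Z + l%:Z) = \sum_(j < n) g j.
  move=> gP; elim: l => [|l <-]; first by under eq_bigr do rewrite addr0.
  have := erefl (\sum_(j < n.+1) g (j%:Z + l%:Z)).
  rewrite {1}big_ord_recl big_ord_recr /= addrC [n%:Z + _]addrC gP add0r.
  move=> /addrI <-.
  by apply: eq_bigr => j _; congr g; rewrite /bump /=; lia.
move=> hP; case: (intP m) => [|l|l]; [exact: shift_nat 0%N hP | exact: shift_nat | ].
rewrite -(shift_nat (fun j => h (j - l.+1%:Z)) l.+1) => [|j].
  by apply: eq_bigr => j _; rewrite addrK.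
by rewrite addrAC hP.
Qed.

Definition dft (F : fieldType) (n : nat) (z : F) (f : int -> F) (q : nat) : F :=
  \sum_(j < n) f j * z ^ (- (q%:Z * j%:Z)).

Lemma prim_root_period (F : numFieldType) (n : nat) (z : F) (a i : int) :
  n.-primitive_root z -> z ^ (a + i * n%:Z) = z ^ a.
Proof.
move=> prim_z; rewrite expfzDr ?(prim_root_neq0 prim_z) // [i * _]mulrC -exprz_exp.
by rewrite -[z ^ n]/(z ^+ n) (prim_expr_order prim_z) exp1rz mulr1.
Qed.

Lemma dft_shift (F : numFieldType) (n q : nat) (i : int) (z : F) (f : int -> F) :
  n.-primitive_root z -> (forall j, f (j + n%:Z) = f j) ->
  dft n z (fun j => f (j + i)) q = z ^ (q%:Z * i) * dft n z f q.
Proof.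
move=> prim_z fP; have z0 := prim_root_neq0 prim_z.
pose h (j : int) := f j * z ^ (q%:Z * i - q%:Z * j).
have hP j : h (j + n%:Z) = h j.
  rewrite /h fP -[in RHS](prim_root_period _ (- q%:Z) prim_z).
  by congr (_ * z ^ _); ring.
transitivity (\sum_(j < n) h (j%:Z + i)).
  by apply: eq_bigr => j _; rewrite /h; congr (_ * z ^ _); ring.
rewrite sum_period_shift // mulr_sumr; apply: eq_bigr => j _.
by rewrite /h expfzDr // mulrCA.
Qed.

Lemma dft_lin (F : numFieldType) (n : nat) (z a b : F) (f g : int -> F) (q : nat) :
  dft n z (fun j => a * f j + b * g j) q = a * dft n z f q + b * dft n z g q.
Proof.
rewrite /dft !mulr_sumr -big_split; apply: eq_bigr => j _ /=.
by rewrite mulrDl !mulrA.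
Qed.

Lemma sum_prim_root (F : numFieldType) (n : nat) (z : F) (j : nat) :
  n.-primitive_root z -> (j < n)%N ->
  \sum_(q < n) z ^ (- (q%:Z * j%:Z)) = (n * (j == 0))%:R.
Proof.
move=> prim_z lt_jn; have n_gt0 := prim_order_gt0 prim_z.
have zqE q : z ^ (- (q%:Z * j%:Z)) = (z ^- j) ^+ q.
  by rewrite -exprVn -exprM mulnC -PoszM -exprz_inv.
under eq_bigr do rewrite zqE.
have [->|j_neq0] := eqVneq j 0.
  by under eq_bigr do rewrite invr1 expr1n; rewrite sumr_const card_ord muln1.
rewrite muln0; have : (z ^- j) ^+ n - 1 = 0.
  by rewrite exprVn exprAC (prim_expr_order prim_z) expr1n invr1 subrr.
rewrite subrX1 => /eqP; rewrite mulf_eq0 subr_eq0 invr_eq1.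
rewrite -(prim_order_dvd prim_z) gtnNdvd ?lt0n //=.
by move/eqP.
Qed.

Lemma dft_inversion (F : numFieldType) (n : nat) (z : F) (f : int -> F) (i : int) :
  n.-primitive_root z -> (forall j, f (j + n%:Z) = f j) ->
  n%:R * f i = \sum_(q < n) dft n z f q * z ^ (q%:Z * i).
Proof.
move=> prim_z fP; have n_gt0 := prim_order_gt0 prim_z.
transitivity (\sum_(q < n) dft n z (fun j => f (j + i)) q); last first.
  by apply: eq_bigr => q _; rewrite dft_shift // mulrC.
rewrite exchange_big /=.
under eq_bigr => j _ do rewrite -mulr_sumr sum_prim_root //.
rewrite (bigD1 (Ordinal n_gt0)) //= muln1 add0r big1 ?addr0 1?mulrC // => j j0.
have -> : (j == 0 :> nat) = false by apply: negbTE.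
by rewrite muln0 mulr0.
Qed.

Lemma dft_const (F : numFieldType) (n : nat) (z c : F) (q : nat) :
  n.-primitive_root z -> (0 < q < n)%N -> dft n z (fun=> c) q = 0.
Proof.
move=> prim_z /andP[q0 qn]; rewrite /dft -mulr_sumr.
under eq_bigr do rewrite mulrC.
by rewrite sum_prim_root // gtn_eqF // muln0 mulr0.
Qed.

(** The condition on chords of step [m] has constant coefficients, so each Fourier
    mode satisfies it separately.  The constant contributes to the mode [0] only,
    by [dft_const]. *)
Lemma chord_relation_dft (F : numFieldType) (n m q : nat) (z c : F) (f g : int -> F) :
  n.-primitive_root z ->
  (forall j, f (j + n%:Z) = f j) -> (forall j, g (j + n%:Z) = g j) ->
  (forall j, z ^+ m * (f (j + m%:Z) + g j) = g (j + m%:Z) + f j + c) ->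
  (z ^+ m * z ^+ m ^+ q - 1) * dft n z f q =
  (z ^+ m ^+ q - z ^+ m) * dft n z g q + dft n z (fun=> c) q.
Proof.
move=> prim_z fP gP rel.
have shiftE (h : int -> F) : (forall j, h (j + n%:Z) = h j) ->
    dft n z (fun j => h (j + m%:Z)) q = z ^+ m ^+ q * dft n z h q.
  move=> hP; rewrite dft_shift // -exprM mulnC; congr (_ * _).
pose fm j := f (j + m%:Z); pose gm j := g (j + m%:Z).
have E : dft n z (fun j => z ^+ m * fm j + z ^+ m * g j) q =
    dft n z (fun j => 1 * gm j + 1 * (1 * f j + 1 * c)) q.
  by apply: eq_bigr => j _; rewrite !mul1r -mulrDr rel addrA.
rewrite (dft_lin n z (z ^+ m) (z ^+ m) fm) (dft_lin n z 1 1 gm) in E.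
rewrite (dft_lin n z 1 1 f (fun=> c)) !mul1r (shiftE f fP) (shiftE g gP) in E.
apply/eqP; rewrite -subr_eq0; apply/eqP.
rewrite -[RHS](subrr (z ^+ m * (z ^+ m ^+ q * dft n z f q) + z ^+ m * dft n z g q)) {2}E.
by ring.
Qed.

(** The modes [2 <= q <= n - 2] vanish by nonresonance, and the mode [1] because the
    relation for step [1] reads [(z^2 - 1) F = 0] there.  What is left of [f] is
    its mean and the mode [n - 1], that is [- 1]. *)
Lemma two_modes (F : numFieldType) (n k : nat) (z c : F) (f g : int -> F) :
  n.-primitive_root z -> (3 <= n)%N ->
  (forall q, (2 <= q)%N -> (q <= n - 2)%N ->
     resonance z (z ^+ k) (z ^+ q) (z ^+ (k * q)) != 0) ->
  (forall j, f (j + n%:Z) = f j) -> (forall j, g (j + n%:Z) = g j) ->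
  (forall j, z * (f (j + 1) + g j) = g (j + 1) + f j) ->
  (forall j, z ^+ k * (f (j + k%:Z) + g j) = g (j + k%:Z) + f j + c) ->
  \sum_(j < n) f j + \sum_(j < n) g j = 0 /\
  exists b : F, forall j, f j = (\sum_(j < n) f j) / n%:R + b * z ^ (- j).
Proof.
move=> prim_z n3 nres fP gP rel1 relk.
have z1 : z - 1 != 0 by rewrite -[z]expr1 (prim_root_sub1_eq0 _ prim_z) gtnNdvd; lia.
have dft0 (h : int -> F) : dft n z h 0 = \sum_(j < n) h j.
  by apply: eq_bigr => j _; rewrite mul0r mulr1.
have rel1' q : (z * z ^+ q - 1) * dft n z f q = (z ^+ q - z) * dft n z g q.
  have := @chord_relation_dft F n 1 q z 0 f g prim_z fP gP.
  rewrite !expr1 => -> => [|j]; last by rewrite addr0.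
  by rewrite [dft n z (fun=> 0) q]big1 ?addr0 // => j _; rewrite mul0r.
have n0 : n%:R != 0 :> F by rewrite pnatr_eq0; lia.
have dft_eq0 q : (0 < q)%N -> (q < n.-1)%N -> dft n z f q = 0.
  move=> q0 qn; have [q1|q1] := eqVneq q 1%N.
    have /eqP := rel1' q; rewrite q1 expr1 subrr mul0r mulf_eq0 -expr2.
    by rewrite (prim_root_sub1_eq0 _ prim_z) gtnNdvd //= => /eqP.
  have relk' := chord_relation_dft q prim_z fP gP relk.
  rewrite dft_const ?q0 ?(leq_trans qn (leq_pred _)) // addr0 -exprM in relk'.
  have res : resonance z (z ^+ k) (z ^+ q) (z ^+ (k * q)) != 0.
    by apply: nres; lia.
  apply: (mulfI res); rewrite mulr0 /resonance.
  transitivity ((z ^+ (k * q) - z ^+ k) * ((z * z ^+ q - 1) * dft n z f q)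
    - (z ^+ q - z) * ((z ^+ k * z ^+ (k * q) - 1) * dft n z f q)); first by ring.
  by rewrite rel1' relk'; ring.
split.
  have := rel1' 0%N; rewrite !dft0 expr0 mulr1 => E.
  by apply: (mulfI z1); rewrite mulrDr E; ring.
exists (dft n z f n.-1 / n%:R) => i.
apply: (mulfI n0); rewrite (dft_inversion i prim_z fP).
have [n' nE] : exists n', n = n'.+2 by exists n.-2; lia.
subst n; rewrite big_ord_recl big_ord_recr /= big1 ?add0r => [|j _]; last first.
  rewrite [dft _ _ _ _]dft_eq0 ?mul0r // /bump /=; have := ltn_ord j; clear; lia.
rewrite mulrDr [n'.+2%:R * (_ / _)]mulrC divfK //.
rewrite mulrA [n'.+2%:R * (_ / _)]mulrC divfK //.
rewrite dft0 mul0r mulr1; congr (_ + _ * _).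
rewrite -[in RHS](prim_root_period _ i prim_z); congr (z ^ _).
by rewrite /bump /= add1n -[n'.+2]addn1 PoszD; ring.
Qed.

(** * The regular polygon in the complex plane *)

Definition cis (R : realType) (x : R) : R[i] := Complex (cos x) (sin x).

Lemma cisD (R : realType) (x y : R) : cis (x + y) = cis x * cis y.
Proof. by rewrite /cis cosD sinD; simpc; congr Complex; ring. Qed.

Lemma cis_neq0 (R : realType) (x : R) : cis x != 0.
Proof.
rewrite /cis eq_complex /= negb_and; have := cos2Dsin2 x.
case: eqVneq => //= ->; case: eqVneq => //= -> /eqP.
by rewrite expr0n addr0 eq_sym oner_eq0.
Qed.

Lemma conj_cis (R : realType) (x : R) : conjc (cis x) = (cis x)^-1.
Proof.
apply: (mulfI (cis_neq0 x)); rewrite divff ?cis_neq0 // /cis; simpc.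
by congr Complex; [rewrite -(cos2Dsin2 x); ring | ring].
Qed.

Lemma cisMz (R : realType) (x : R) (j : int) : cis (x * j%:~R) = cis x ^ j.
Proof.
have nat_case (l : nat) : cis (x * l%:R) = cis x ^ l%:Z.
  elim: l => [|l IH]; first by rewrite mulr0 /cis cos0 sin0.
  by rewrite exprSzr -IH -cisD mulrS mulrDr mulr1 addrC.
case: (intP j) => [|l|l]; [exact: nat_case 0%N | exact: nat_case | ].
rewrite mulrN -invr_expz -nat_case -conj_cis /cis.
by rewrite cosN sinN; simpc.
Qed.

Lemma cis_prim_root (R : realType) (n : nat) : (0 < n)%N ->
  n.-primitive_root (cis (pi / n%:R : R) ^+ 2).
Proof.
move=> n_gt0; have n0 : n%:R != 0 :> R by rewrite pnatr_eq0 -lt0n.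
have powE l : (cis (pi / n%:R : R) ^+ 2) ^+ l = cis (pi / n%:R * l%:R) ^+ 2.
  by rewrite exprAC; congr (_ ^+ 2); have := cisMz (pi / n%:R) l => ->.
apply/andP; split=> //; apply/forallP => i; rewrite unity_rootE powE.
rewrite sqrf_eq1.
have [iE | neq_in] := eqVneq i.+1 n.
  rewrite iE divfK // /cis cospi sinpi -[Complex (-1) 0]/(real_complex R (-1)).
  by rewrite rmorphN1 eqxx orbT.
rewrite eqbF_neg negb_or !eq_complex /= oppr0 !negb_and.
suff -> : sin (pi / n%:R * i.+1%:R : R) != 0 by rewrite !orbT.
have lt_in : (i.+1 < n)%N by rewrite ltn_neqAle neq_in ltn_ord.
rewrite gt_eqF // sin_gt0_pi // -mulrA mulr_gt0 ?pi_gt0 //=; last first.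
  by rewrite mulr_gt0 ?invr_gt0 ?ltr0n.
by rewrite gtr_pMr ?pi_gt0 // mulrC ltr_pdivrMr ?ltr0n // mul1r ltr_nat.
Qed.

Definition to_complex (R : realType) (u : 'cV[R]_2) : R[i] :=
  Complex (u ord0 ord0) (u ord_max ord0).

Lemma bracketE (R : realType) (u v : 'cV[R]_2) :
  bracket u v = u ord0 ord0 * v ord_max ord0 - u ord_max ord0 * v ord0 ord0.
Proof.
have l0 : lift ord0 ord0 = ord_max :> 'I_2 by apply: val_inj.
have l1 : lift ord_max ord0 = ord0 :> 'I_2 by apply: val_inj.
have s0 : split (ord0 : 'I_(1 + 1)) = inl ord0.
  by case: splitP => // i _; rewrite ord1.
have s1 : split (ord_max : 'I_(1 + 1)) = inr ord0.
  by case: splitP => [[[|//] ?]|i _] //; rewrite ord1.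
rewrite /bracket (expand_det_row _ ord0) big_ord_recl big_ord1 l0.
rewrite /cofactor !det_mx11 !mxE /=.
rewrite ?l0 ?l1 s0 s1; ring.
Qed.

Lemma to_complex_inj (R : realType) : injective (@to_complex R).
Proof.
move=> u v [u0 u1]; apply/colP => i; have [i0|i1] : i = ord0 \/ i = ord_max.
  by case: i => [[|[|//]] ?]; [left|right]; apply: val_inj.
- by rewrite i0.
- by rewrite i1.
Qed.

Lemma to_complex_bracket (R : realType) (u v : 'cV[R]_2) :
  conjc (to_complex u) * to_complex v - to_complex u * conjc (to_complex v) =
  Complex 0 (2 * bracket u v).
Proof. by rewrite bracketE /to_complex; simpc; congr Complex; ring. Qed.

Lemma regular_polygonE (R : realType) (n : nat) (r : R) (j : int) :
  to_complex (regular_polygon n r j) = real_complex R r * cis (pi / n%:R) ^ j.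
Proof.
by rewrite -cisMz /to_complex !mxE /= /cis mulrAC; simpc.
Qed.

(** For complex vectors the bracket is the imaginary part of [conj(u) v].  Dividing
    by the rotation [w^j] makes the coefficients independent of [j], and
    multiplying by [w^m] leaves only powers of [w^2]. *)
Lemma chord_relation (R : realType) (n m : nat) (r c : R) (V : int -> 'cV[R]_2) :
  let P := regular_polygon n r in
  let w : R[i] := cis (pi / n%:R) in
  let f (j : int) : R[i] := to_complex (V j) * w ^ (- j) in
  0 < r ->
  (forall j : int, bracket (P j) (V (j + m%:Z)) + bracket (V j) (P (j + m%:Z)) = c) ->
  forall j : int, w ^+ 2 ^+ m * (f (j + m%:Z) + conjc (f j)) =
    conjc (f (j + m%:Z)) + f j + w ^+ m * (Complex 0 (2 * c) / real_complex R r).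
Proof.
move=> P w f r0 rel j.
have w0 : w != 0 := cis_neq0 _.
have rC0 : real_complex R r != 0.
  by rewrite fmorph_eq0 gt_eqF.
have conj_w i : conjc (w ^ i) = w ^ (- i).
  by rewrite /w -[X in conjc X]cisMz conj_cis cisMz invr_expz.
have vE i : to_complex (V i) = f i * w ^ i.
  by rewrite /f -mulrA -expfzDr // addNr mulr1.
have conjM (a b : R[i]) : conjc (a * b) = conjc a * conjc b := rmorphM _ a b.
have conj_r : conjc (real_complex R r) = real_complex R r := conjc_real r.
have /(congr1 (fun x => Complex 0 (2 * x))) := rel j; rewrite mulrDr.
have -> (x y : R) : Complex 0 (x + y) = Complex 0 x + Complex 0 y by simpc.
rewrite -!to_complex_bracket !regular_polygonE !vE -/w => E.
clearbody f; rewrite !conjM !conj_w conj_r -!invr_expz !expfzDr // in E.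
move: E; rewrite -[w ^ m%:Z]/(w ^+ m) -exprAC => <-.
have := expfz_neq0 j w0; have := expf_neq0 m w0.
move: (f _) (f j) (conjc _) (conjc _) (w ^ j) (w ^+ m) (real_complex R r) rC0.
move=> {conj_r} F1 F0 G1 G0 X Y rr rr0 Y0 X0.
by field; rewrite rr0 Y0 X0.
Qed.

(** The real-linear map [u -> i a u + b conj(u)] of the complex plane.  Every
    traceless real 2 x 2 matrix has this form. *)
Definition sl2_mx (R : realType) (a : R) (b : R[i]) : 'M[R]_2 :=
  \matrix_(i, j) (if i == ord0 then (if j == ord0 then complex.Re b else complex.Im b - a)
                  else (if j == ord0 then complex.Im b + a else - complex.Re b)).

Lemma sl2_mx_tr (R : realType) (a : R) (b : R[i]) : \tr (sl2_mx a b) = 0.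
Proof. by rewrite /mxtrace big_ord_recl big_ord1 !mxE /= subrr. Qed.

Lemma to_complex_sl2_mx (R : realType) (a : R) (b : R[i]) (u : 'cV[R]_2) :
  to_complex (sl2_mx a b *m u) =
  Complex 0 a * to_complex u + b * conjc (to_complex u).
Proof.
have lE : lift ord0 ord0 = ord_max :> 'I_2 by apply: val_inj.
rewrite /to_complex !mxE !big_ord_recl !big_ord0 /= lE !mxE /=.
by case: b => b0 b1; simpc; congr Complex; rewrite /=; ring.
Qed.

Theorem theorem11 (R : realType) (n k : nat) (r : R)
    (hk2 : (2 <= k)%N) (hkn : (2 * k <= n)%N)
    (hr : 0 < r)
    (hP : forall j : int,
       bracket (regular_polygon n r j) (regular_polygon n r (j + 1)) = 1)
    (not1 : ~ (~~ odd n /\ odd k))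
    (not2 : ~ [/\ n = (2 * k)%N, ~~ odd k & (2 < k)%N])
    (not3 : ~ exists j : nat,
       [/\ (2 <= j)%N, (j <= n - 2)%N, n = (2 * (k + j))%N
         & (n %| (k - 1) * (j - 1))%N]) :
  infinitesimally_rigid n k (regular_polygon n r).
Proof.
move=> V [Vn rel1 [c relk]].
have n_gt0 : (0 < n)%N by lia.
pose w : R[i] := cis (pi / n%:R).
have w0 : w != 0 := cis_neq0 _.
have wn : w ^ n%:Z = -1.
  rewrite /w -cisMz divfK ?pnatr_eq0 -?lt0n // /cis cospi sinpi.
  by rewrite -[LHS]/(real_complex R (-1)) rmorphN1.
pose f (j : int) : R[i] := to_complex (V j) * w ^ (- j).
have fP j : f (j + n%:Z) = f j.
  rewrite /f Vn opprD expfzDr // -[w ^ (- n%:Z)]invr_expz wn invrN1 mulrN1.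
  have -> : to_complex (- V j) = - to_complex (V j) by rewrite /to_complex !mxE.
  by rewrite mulrNN.
have gP j : conjc (f (j + n%:Z)) = conjc (f j) by rewrite fP.
have prim_z := cis_prim_root R n_gt0.
have := @chord_relation R n 1 r 0 V hr rel1; rewrite -/w mulr0 mul0r mulr0 !expr1 => E1.
have Ek := @chord_relation R n k r c V hr relk.
have nres q (q2 : (2 <= q)%N) (qn : (q <= n - 2)%N) :=
  resonance_neq0 prim_z hk2 hkn q2 qn not1 not2 not3.
have [] := @two_modes _ n k (w ^+ 2) _ f (fun j => conjc (f j)) prim_z _ nres fP gP _ Ek.
- lia.
- by move=> j; have := E1 j; rewrite addr0.
set S := \sum_(j < n) f j => S0 [b fE].
(* The mean is purely imaginary, so it acts as an infinitesimal rotation. *)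
have [s SE] : exists s, S / n%:R = Complex 0 s.
  have /eqP : S + conjc S = 0 by rewrite rmorph_sum.
  rewrite addcJ mulf_eq0 (pnatr_eq0 _ 2) /= fmorph_eq0 => /eqP ReS.
  exists (complex.Im S / n%:R); rewrite [S in LHS]complexE ReS.
  have n0 : n%:R != 0 :> R by rewrite pnatr_eq0 -lt0n.
  apply: (@mulIf _ n%:R); first by rewrite pnatr_eq0 -lt0n.
  rewrite divfK ?pnatr_eq0 -?lt0n // -(rmorph_nat (real_complex R)) add0r.
  by simpc; rewrite divfK.
(* [w ^ j] is [P_j / r] and [w ^ (- j)] is its conjugate. *)
exists (sl2_mx (s / r) (b / real_complex R r)); first exact: sl2_mx_tr.
move=> j; apply: to_complex_inj.
have rC0 : real_complex R r != 0 by rewrite fmorph_eq0 gt_eqF.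
have -> : to_complex (V j) = f j * w ^ j.
  by rewrite /f -mulrA -expfzDr // addNr mulr1.
rewrite to_complex_sl2_mx regular_polygonE -/w.
have -> : conjc (real_complex R r * w ^ j) = real_complex R r * w ^ (- j).
  transitivity (conjc (real_complex R r) * conjc (w ^ j)); first exact: rmorphM.
  by congr (_ * _); [exact: conjc_real | rewrite /w -cisMz conj_cis cisMz invr_expz].
have -> : Complex 0 (s / r) = Complex 0 s / real_complex R r.
  by apply: (mulIf rC0); rewrite divfK //; simpc; rewrite divfK ?gt_eqF.
rewrite fE SE -[(w ^+ 2) ^ _]/((w ^ 2%:Z) ^ _) exprz_exp.
have -> : w ^ (2%:Z * - j) = w ^ (- j) * w ^ (- j) by rewrite -expfzDr //; congr (_ ^ _); ring.
rewrite -invr_expz; move: (Complex 0 s) (real_complex R r) rC0 (w ^ j) (expfz_neq0 j w0).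
by move=> ia rr rr0 X X0; field; rewrite rr0 X0.
Qed.
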